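(* There exists an explicit size-preserving bijection between the family of steady paths and $AV(1\text{-}34\text{-}2)$; that is, for every $n\ge1$, a bijection between the steady paths of size $n$ and $AV_n(1\text{-}34\text{-}2)$.
   Context: A steady path of size $n$ is a lattice path $P$ confined to the cone $\mathfrak{C}=\{(x,y)\in\mathbb{N}^2: y\le x\}$, using steps $U=(1,1)$, $D=(1,-1)$ and $W=(-1,1)$, without any factor (pair of consecutive steps) $WD$ or $DW$, starting at $(0,0)$ and ending at $(2n,0)$, such that: (S1) for any factor $UU$, the suffix of $P$ following this $UU$ factor lies weakly below the line parallel to $y=x$ passing through the $UU$ factor; (S2) for any factor $WU$, the suffix of $P$ following this $WU$ factor lies weakly below the line parallel to $y=x$ passing through the up step $U$ of the $WU$ factor. $AV_n(1\text{-}34\text{-}2)$ is the set of permutations $\pi=\pi_1\cdots\pi_n$ of $\{1,\ldots,n\}$ for which there are no indices $i<j$ and $\ell>j+1$ with $\pi_i<\pi_\ell<\pi_j<\pi_{j+1}$, and $AV(1\text{-}34\text{-}2)=\bigcup_n AV_n(1\text{-}34\text{-}2)$. *)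

(* Defs.v *)
From HB Require Import structures.
From mathcomp Require Import all_boot all_order all_algebra all_fingroup.

Set Implicit Arguments.
Unset Strict Implicit.
Unset Printing Implicit Defensive.

Import GRing.Theory Num.Theory.
Local Open Scope ring_scope.

Inductive step : Type := U | D | W.

Definition step_code (s : step) : option bool :=
  match s with U => None | D => Some true | W => Some false end.

Definition step_decode (c : option bool) : step :=
  match c with None => U | Some true => D | Some false => W end.

Lemma step_codeK : cancel step_code step_decode.
Proof. by case. Qed.

HB.instance Definition _ := Finite.copy step (can_type step_codeK).

(* Coordinates are integers, as W decreases the abscissa; nonnegativity is
   part of [in_cone]. *)
Definition point : Type := (int * int)%type.

Definition move (q : point) (s : step) : point :=
  match s with
  | U => (q.1 + 1, q.2 + 1)
  | D => (q.1 + 1, q.2 - 1)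
  | W => (q.1 - 1, q.2 + 1)
  end.

(* The point reached after the first [i] steps of [P], from the origin; for
   [i >= size P] it is the endpoint. *)
Definition vertex (P : seq step) (i : nat) : point :=
  foldl move (0, 0) (take i P).

Definition in_cone (q : point) : bool :=
  [&& 0 <= q.1, 0 <= q.2 & q.2 <= q.1].

(* [q] lies weakly below the line parallel to y = x passing through [p]. *)
Definition weakly_below (q p : point) : bool :=
  q.2 - q.1 <= p.2 - p.1.

(* Steps [i] and [i+1] of [P] (numbered from 0) are [s] and [t]; they join
   [vertex P i], [vertex P i.+1] and [vertex P i.+2]. *)
Definition factor_at (s t : step) (P : seq step) (i : nat) : bool :=
  take 2 (drop i P) == [:: s; t].

(* In (S1) and (S2) the suffix following the factor at [i] has vertices
   [vertex P k] for [i + 2 <= k <= size P].  Its edges are line segments, so it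
   lies in a closed half-plane as soon as these vertices do. *)
Definition steadyS1 (P : seq step) : bool :=
  [forall i : 'I_(size P), forall k : 'I_(size P).+1,
     factor_at U U P i ==> (i.+2 <= k)%N ==>
       weakly_below (vertex P k) (vertex P i)].

(* The up step of a factor WU at [i] starts at [vertex P i.+1]. *)
Definition steadyS2 (P : seq step) : bool :=
  [forall i : 'I_(size P), forall k : 'I_(size P).+1,
     factor_at W U P i ==> (i.+2 <= k)%N ==>
       weakly_below (vertex P k) (vertex P i.+1)].

Definition steady (n : nat) (P : seq step) : bool :=
  [&& [forall k : 'I_(size P).+1, in_cone (vertex P k)],
      vertex P (size P) == ((2 * n)%N%:Z, 0),
      ~~ infix [:: W; D] P,
      ~~ infix [:: D; W] P,
      steadyS1 P
    & steadyS2 P].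

(* [n] is the size of the path in the sense of its endpoint (2n,0), not its
   number of steps. *)
Definition steady_path (n : nat) : Type := {P : seq step | steady n P}.

(* Permutations of {1,...,n} are represented on 'I_n = {0,...,n-1}; shifting
   positions and values by one does not affect pattern avoidance. *)
Definition avoids_1_34_2 (n : nat) (p : 'S_n) : bool :=
  ~~ [exists i : 'I_n, exists j : 'I_n, exists j' : 'I_n, exists l : 'I_n,
        [&& (i < j)%N, j' == j.+1 :> nat, (j.+1 < l)%N,
            (p i < p l)%N, (p l < p j)%N & (p j < p j')%N]].

Definition AV_1_34_2 (n : nat) : Type := {p : 'S_n | avoids_1_34_2 p}.

(* Main.v *)
Require Import Defs.
From mathcomp Require Import all_boot all_order all_algebra all_fingroup.
From mathcomp Require Import zify.

Set Implicit Arguments.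
Unset Strict Implicit.
Unset Printing Implicit Defensive.
Import GRing.Theory Num.Theory.

Local Open Scope nat_scope.

(** In the coordinates a = (x - y) / 2 and b = (x + y) / 2 the step U raises b,
    D raises a and W lowers a, and the cone becomes 0 <= a <= b.  Between two
    up steps a path only moves in the a direction, and the prohibition of WD
    and DW makes this move monotone: it is determined by its two ends.  A path
    from (0,0) to (2n,0) therefore amounts to the word e_0, ..., e_{n-1}, e_n
    listing the value of a at each up step and at the end, subject to
    e_k <= k and e_n = n ([path_of], [path_ofK], [offsetsK]).

    A line parallel to y = x is a level line of a.  The up step leaving from
    e_{k+1} is the second step of a factor UU when e_{k+1} = e_k and of a
    factor WU when e_{k+1} < e_k, so (S1) and (S2) together say: whenever
    e_{k+1} <= e_k, every later e_j satisfies e_j >= e_{k+1}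
    ([supported_climb], [steady_path_ofP]).

    On the other side, encode a permutation p by its Lehmer code, where c_i is
    the number of later entries smaller than p_i, and read the code from right
    to left.  Reversed codes are exactly the words with e_k <= k, the
    inequality e_{k+1} <= e_k marks an ascent p_j < p_{j+1}, and avoidance of
    1-34-2 says that c_i >= c_j for all i < j whenever j is an ascent
    ([avoids_lehmerP]): the same condition.  Drawing the path of the reversed
    Lehmer code is thus a bijection from permutations to steady paths, and its
    inverse is the required map. *)

(** * Coordinates adapted to the steps *)

(** The contribution of a step to a = (x - y) / 2. *)
Definition drift (s : step) : int :=
  match s with U => 0 | D => 1 | W => -1 end%R.

Definition offset (P : seq step) : int := (\sum_(s <- P) drift s)%R.

Definition ups (P : seq step) : nat := count_mem U P.

Lemma offset_cons s P : offset (s :: P) = (drift s + offset P)%R.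
Proof. by rewrite /offset big_cons. Qed.

Lemma foldl_moveE P (a b : int) :
  foldl move (b + a, b - a)%R P =
  (b + Posz (ups P) + (a + offset P), b + Posz (ups P) - (a + offset P))%R.
Proof.
elim: P a b => [|s P IH] a b.
  by rewrite /offset big_nil /=; congr pair; lia.
have -> : foldl move (b + a, b - a)%R (s :: P) =
  foldl move ((b + Posz (s == U)) + (a + drift s),
              (b + Posz (s == U)) - (a + drift s))%R P.
  by rewrite /=; congr foldl; case: s => /=; congr pair; lia.
by rewrite IH offset_cons /ups /= PoszD; congr pair; lia.
Qed.

Lemma vertexE P i :
  vertex P i = ((ups (take i P))%:Z + offset (take i P),
                (ups (take i P))%:Z - offset (take i P))%R.
Proof.
rewrite /vertex -[X in foldl _ X]/((0 + 0)%R : int, (0 - 0)%R : int).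
rewrite foldl_moveE.
by congr pair; lia.
Qed.

Lemma in_cone_vertex P i :
  in_cone (vertex P i) =
  (0 <= offset (take i P) <= (ups (take i P))%:Z)%R.
Proof. by rewrite vertexE /in_cone /=; lia. Qed.

Lemma weakly_below_vertex P i k :
  weakly_below (vertex P k) (vertex P i) =
  (offset (take i P) <= offset (take k P))%R.
Proof. by rewrite !vertexE /weakly_below /=; lia. Qed.

(** All vertices of a path that starts at (a, b) satisfy [Q].  The cone and the
    half-planes of the steadiness conditions are both of this kind; the
    recursion on the path lets them be computed along runs. *)
Fixpoint stays (Q : int -> nat -> bool) (a : int) (b : nat) (P : seq step) :=
  Q a b && (if P is s :: P' then stays Q (a + drift s)%R ((s == U) + b) P'
            else true).

Lemma staysP (Q : int -> nat -> bool) a b P :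
  reflect (forall k, k <= size P ->
             Q (a + offset (take k P))%R (ups (take k P) + b))
          (stays Q a b P).
Proof.
have off0 : offset [::] = 0%R by rewrite /offset big_nil.
elim: P a b => [|s P IH] a b /=.
  rewrite andbT; apply: (iffP idP) => [q [|//] _|/(_ 0 isT)];
  by rewrite /= off0 addr0.
apply: (iffP andP) => [[q /IH h] [|k] lek|h].
- by rewrite take0 off0 addr0.
- have := h k lek; rewrite /= offset_cons addrA.
  by rewrite /ups /= addnA -(addnC (s == U)).
- split; first by have := h 0 isT; rewrite take0 off0 addr0.
  apply/IH => k lek; have := h k.+1 lek; rewrite /= offset_cons addrA.
  by rewrite /ups /= addnA -(addnC (s == U)).
Qed.

Lemma stays_start Q a b P : stays Q a b P -> Q a b.
Proof. by case: P => [|s P] /andP[]. Qed.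

(** * Runs and steadiness along a path *)

Definition run (a e : nat) : seq step :=
  if a <= e then nseq (e - a) D else nseq (a - e) W.

Lemma run_id a : run a a = [::].
Proof. by rewrite /run leqnn subnn. Qed.

Lemma run_up a e : a < e -> run a e = D :: run a.+1 e.
Proof. by move=> lt; rewrite /run (ltnW lt) lt -(subnSK lt). Qed.

Lemma run_down a e : e <= a -> run a.+1 e = W :: run a e.
Proof.
move=> le; rewrite /run ltnNge le /= subSn //; case: leqP => // le'.
by rewrite (_ : a = e) ?subnn //; apply/eqP; rewrite eqn_leq le'.
Qed.

(** Induction on the distance to the target, whichever side it lies on. *)
Lemma run_ind e (T : nat -> Prop) :
  T e -> (forall a, a < e -> T a.+1 -> T a) ->
  (forall a, e <= a -> T a -> T a.+1) -> forall a, T a.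
Proof.
move=> Te up down a; case: (leqP a e) => [le|/ltnW le].
- rewrite -(subKn le); elim: (e - a) (leq_subr a e) => [|d IH] led.
    by rewrite subn0.
  by apply: up; [lia|rewrite subnSK //; apply: IH; lia].
- rewrite -(subnK le); elim: (a - e) => [//|d IH].
  by rewrite addSn; apply: down => //; lia.
Qed.

(** A run is a segment, so a convex condition needs checking only at its two
    ends. *)
Lemma stays_run (Q : int -> nat -> bool) a e b P :
  (forall x y z : int, Q x b -> Q z b -> (x <= y <= z)%R -> Q y b) ->
  stays Q (Posz a) b (run a e ++ P) = Q a b && stays Q (Posz e) b P.
Proof.
move=> convex; elim/(run_ind (e := e)): a => [|a lt IH|a le IH].
- rewrite run_id /=; apply/idP/andP => [h|[]//].
  by split=> //; apply: stays_start h.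
- rewrite run_up //= add0n (_ : (a%:Z + 1 = a.+1%:Z)%R); last by lia.
  rewrite IH; case Qa: (Q a b) => //=.
  case h: (stays Q e b P); rewrite ?andbF ?andbT //.
  by apply: (convex _ _ _ Qa (stays_start h)); lia.
- rewrite run_down //= add0n (_ : (a.+1%:Z - 1 = a%:Z)%R); last by lia.
  rewrite IH; case Qa: (Q a.+1 b) => //=.
  case h: (stays Q e b P); rewrite ?andbF ?andbT //.
  by apply: (convex _ _ _ (stays_start h) Qa); lia.
Qed.

(** (S1) and (S2) in one recursion: [t] is the step that precedes [P], and an
    up step that does not come after D keeps the rest of the path weakly below
    its line.  With [t := D] the first step carries no condition. *)
Fixpoint supported (a : int) (t : step) (P : seq step) :=
  if P is s :: P' then
    ((t != D) && (s == U) ==> stays (fun x _ => a <= x)%R a 0 P') &&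
    supported (a + drift s)%R s P'
  else true.

Lemma supportedP a t P :
  reflect (forall i k, i < k <= size P -> nth D P i = U ->
             nth D (t :: P) i != D ->
             (offset (take i P) <= offset (take k P))%R)
          (supported a t P).
Proof.
elim: P a t => [|s P IH] a t /=; first by constructor=> i k; lia.
apply: (iffP andP) => [[/implyP h /IH h'] [|i] [|k] //|h].
- move=> lek /= sU tD; move: h; rewrite sU eqxx tD => /(_ isT)/staysP/(_ k lek).
  by rewrite offset_cons /offset big_nil add0r lerDl.
- by move=> lek /= Pi Pi'; rewrite !offset_cons lerD2l h'.
- split.
    apply/implyP=> /andP[tD /eqP sU]; apply/staysP => k lek.
    have := h 0 k.+1 lek sU tD; rewrite /= sU offset_cons /offset big_nil.
    by rewrite add0r lerDl.
  apply/IH => i k lek Pi Pi'; have := h i.+1 k.+1 lek Pi Pi'.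
  by rewrite /= !offset_cons lerD2l.
Qed.

Definition turns (s t : step) : bool :=
  ((s == W) && (t == D)) || ((s == D) && (t == W)).

Lemma infix2_sorted (T : eqType) (x y : T) s :
  ~~ infix [:: x; y] s = sorted (fun a b => ~~ ((a == x) && (b == y))) s.
Proof.
elim: s => [|a [|b s] IH] //=; first by rewrite andbF.
by move: IH => /= <-; rewrite prefix0s andbT negb_or (eq_sym x) (eq_sym y).
Qed.

Lemma no_turns P :
  ~~ infix [:: W; D] P && ~~ infix [:: D; W] P =
  sorted (fun s t => ~~ turns s t) P.
Proof.
rewrite !infix2_sorted; case: P => //= s P.
elim: P s => //= t P IH s; rewrite -IH /turns negb_or.
by rewrite -!andbA; do !bool_congr.
Qed.

(** The default step D of [nth] is harmless because [t] differs from it. *)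
Lemma factor_atE (s t : step) P i : t != D ->
  factor_at s t P i =
  (i.+1 < size P) && (nth D P i == s) && (nth D P i.+1 == t).
Proof.
move=> tD; rewrite /factor_at; elim: P i => [|x P IH] [|i] //=.
case: P {IH} => [|y P]; first by rewrite eqseq_cons andbF.
by rewrite /= take0 !eqseq_cons andbT.
Qed.

(** The line of a factor UU passes through its middle vertex as well, so in both
    conditions the reference point is the start of the second step. *)
Lemma steadyS12 P : steadyS1 P && steadyS2 P = supported 0 D P.
Proof.
have nthU i : nth D P i = U -> i < size P.
  by move=> Pi; rewrite ltnNge; apply/negP => le; move: Pi; rewrite nth_default.
apply/andP/supportedP => [[/forallP h1 /forallP h2] [//|i] k|h].
  move=> /andP[ik kP] PiU /= PiD.
  have [ik'|] := boolP (i.+2 <= k); last first.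
    by move=> ?; have -> : k = i.+1 by lia.
  have iP := ltnW (nthU _ PiU).
  move: (h1 (Ordinal iP)) => /forallP/(_ (Ordinal (kP : k < (size P).+1))).
  move: (h2 (Ordinal iP)) => /forallP/(_ (Ordinal (kP : k < (size P).+1))).
  rewrite /= !factor_atE // !weakly_below_vertex (nthU _ PiU) PiU eqxx ik'.
  case E: (nth D P i) PiD => //= _ _.
  by rewrite (take_nth D) // E /offset -cats1 big_cat big_seq1 /= addr0.
split; apply/forallP => i; apply/forallP => k; apply/implyP;
  rewrite factor_atE // => /andP[/andP[iP /eqP Pi] /eqP Pi'];
  apply/implyP => ik; rewrite weakly_below_vertex.
  have := h i.+1 k; rewrite ik /= Pi => /(_ _ Pi' isT).
  rewrite (take_nth D) // Pi /offset -cats1 big_cat big_seq1 /= addr0; apply.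
  by rewrite -ltnS.
by apply: h => //=; rewrite ?Pi // ik -ltnS /=.
Qed.

Definition cone (a : int) (b : nat) : bool := (0 <= a <= b%:Z)%R.

Lemma steadyE n P :
  steady n P =
  [&& stays cone 0 0 P, offset P == n, ups P == n,
      sorted (fun s t => ~~ turns s t) P & supported 0 D P].
Proof.
rewrite /steady -steadyS12 -no_turns vertexE take_size xpair_eqE.
have -> : [forall k : 'I_(size P).+1, in_cone (vertex P k)] = stays cone 0 0 P.
  apply/forallP/staysP => [h k lek|h k].
    have := h (Ordinal (lek : k < (size P).+1)).
    by rewrite in_cone_vertex add0r addn0.
  by have := h k (ltn_ord k); rewrite in_cone_vertex add0r addn0.
rewrite -!andbA; congr (_ && _); rewrite !andbA; do 4 congr (_ && _); lia.
Qed.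

(** * Paths as words of offsets *)

Fixpoint climb (a : nat) (es : seq nat) : seq step :=
  if es is e :: es' then U :: run a e ++ climb e es' else [::].

(** The initial run is empty for words that start with 0, as those of paths in
    the cone do; allowing it makes [offsets 0] a left inverse on all nonempty
    words. *)
Definition path_of (es : seq nat) : seq step :=
  run 0 (head 0 es) ++ climb (head 0 es) (behead es).

Fixpoint offsets (a : nat) (P : seq step) : seq nat :=
  match P with
  | [::] => [:: a]
  | U :: P' => a :: offsets a P'
  | D :: P' => offsets a.+1 P'
  | W :: P' => offsets a.-1 P'
  end.

Lemma offsets_run a e P : offsets a (run a e ++ P) = offsets e P.
Proof.
elim/(run_ind (e := e)): a => [|a lt IH|a le IH]; rewrite ?run_id //.
  by rewrite run_up.
by rewrite run_down.
Qed.

Lemma offsets_climb a es : offsets a (climb a es) = a :: es.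
Proof. by elim: es a => //= e es IH a; rewrite offsets_run IH. Qed.

Lemma path_ofK es : 0 < size es -> offsets 0 (path_of es) = es.
Proof. by case: es => // e es _; rewrite offsets_run offsets_climb. Qed.

Lemma offsets_gt0 a P : 0 < size (offsets a P).
Proof. by elim: P a => [|[] P IH] a //=; apply: IH. Qed.

(** Absence of turns makes the first step of [P] agree with the run that it
    starts; without it, [offsets] would forget backtracking moves. *)
Lemma offsetsK a b P :
  stays cone (Posz a) b P -> sorted (fun s t => ~~ turns s t) P ->
  P = run a (head 0 (offsets a P)) ++
      climb (head 0 (offsets a P)) (behead (offsets a P)).
Proof.
elim: P a b => [|s P IH] a b; first by rewrite /= run_id.
rewrite [stays _ _ _ _]/= => /andP[_ h] srt.
have srtP : sorted (fun s t => ~~ turns s t) P by apply: path_sorted srt.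
case: s h srt => h srt.
- rewrite /= run_id /= {1}(IH a b.+1) //.
    by case: (offsets a P) (offsets_gt0 a P) => //= e es.
  by move: h; rewrite /= addr0.
- rewrite [offsets _ _]/=; set es := offsets a.+1 P.
  have E := IH a.+1 b; rewrite -/es in E.
  have {}E : P = run a.+1 (head 0 es) ++ climb (head 0 es) (behead es).
    apply: E => //; move: h.
    by rewrite /= add0n (_ : (a%:Z + 1 = a.+1%:Z)%R); last by lia.
  case: (ltnP a (head 0 es)) => [lt|le]; first by rewrite run_up //= -E.
  by move: srt; rewrite E run_down.
- case: a h => [/stays_start|a] h; first by rewrite /cone /= in h; lia.
  rewrite [offsets _ _]/=; set es := offsets a P.
  have E := IH a b; rewrite -/es in E.
  have {}E : P = run a (head 0 es) ++ climb (head 0 es) (behead es).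
    apply: E => //; move: h.
    by rewrite /= add0n (_ : (a.+1%:Z - 1 = a%:Z)%R); last by lia.
  case: (leqP (head 0 es) a) => [lt|le]; first by rewrite run_down //= -E.
  by move: srt; rewrite E run_up.
Qed.

Lemma offset_cat P Q : offset (P ++ Q) = (offset P + offset Q)%R.
Proof. by rewrite /offset big_cat. Qed.

Lemma ups_cat P Q : ups (P ++ Q) = ups P + ups Q.
Proof. exact: count_cat. Qed.

Lemma offset_run a e : (offset (run a e) = Posz e - Posz a)%R.
Proof.
elim/(run_ind (e := e)): a => [|a lt IH|a le IH].
- by rewrite run_id /offset big_nil subrr.
- by rewrite run_up // offset_cons IH /=; lia.
- by rewrite run_down // offset_cons IH /=; lia.
Qed.

Lemma offset_climb a es : (offset (climb a es) = Posz (last a es) - Posz a)%R.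
Proof.
elim: es a => [|e es IH] a; first by rewrite /offset big_nil /= subrr.
by rewrite [climb _ _]/= offset_cons offset_cat offset_run IH /=; lia.
Qed.

Lemma ups_run a e : ups (run a e) = 0.
Proof. by rewrite /ups /run; case: ifP; rewrite count_nseq. Qed.

Lemma ups_climb a es : ups (climb a es) = size es.
Proof.
elim: es a => //= e es IH a.
by rewrite -(IH e) -[LHS]/(ups _).+1 ups_cat ups_run.
Qed.

Lemma turnless_run a e Q :
  (forall s, path (fun s t => ~~ turns s t) s Q) ->
  forall s, (a < e -> s != W) -> (e < a -> s != D) ->
  path (fun s t => ~~ turns s t) s (run a e ++ Q).
Proof.
move=> pathQ; elim/(run_ind (e := e)): a => [|a lt IH|a le IH] s sW sD.
- by rewrite run_id.
- rewrite run_up //= IH // ?andbT; last by lia.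
  by case: s {sD} sW => //= /(_ lt).
- rewrite run_down //= IH // ?andbT; last by lia.
  by case: s {sW} sD => //= /(_ le).
Qed.

Lemma turnless_climb a es s : path (fun s t => ~~ turns s t) s (climb a es).
Proof.
elim: es a s => [|e es IH] a s //=.
by rewrite turnless_run //; case: s.
Qed.

(** A run contains no up step: it carries no condition, and acts only through
    its displacement and its last step. *)
Lemma supported_run x a e t P :
  supported x t (run a e ++ P) =
  supported (x + e%:Z - a%:Z)%R (if e < a then W else if a < e then D else t) P.
Proof.
elim/(run_ind (e := e)): a x t => [|a lt IH|a le IH] x t.
- by rewrite run_id ltnn /=; congr supported; lia.
- rewrite run_up //= andbF /= IH if_same lt !ifN -?leqNgt ?(ltnW lt) //.
  by congr supported; lia.
- rewrite run_down //= andbF /= IH ltnS le [a < e]ltnNge le if_same.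
  by congr supported; lia.
Qed.

(** The trace of (S1) and (S2) on words, for [es] preceded by the letter [a]. *)
Fixpoint floors (a : nat) (es : seq nat) : bool :=
  if es is e :: es' then ((e <= a) ==> all (leq e) es') && floors e es'
  else true.

Lemma stays_above m a b es :
  stays (fun x _ => Posz m <= x)%R (Posz a) b (climb a es) =
  all (leq m) (a :: es).
Proof.
elim: es a b => [|e es IH] a b //=.
rewrite addr0 stays_run; last by move=> x y z; lia.
by rewrite IH /= !lez_nat; case: leqP.
Qed.

Lemma stays_cone a b es :
  reflect (forall k, k <= size es -> nth 0 (a :: es) k <= b + k)
          (stays cone (Posz a) b (climb a es)).
Proof.
elim: es a b => [|e es IH] a b.
  rewrite /= /cone lez_nat /= andbT.
  by apply: (iffP idP) => [le [|//]|/(_ 0 isT)]; rewrite addn0.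
rewrite /= addr0 stays_run; last by rewrite /cone => x y z; lia.
rewrite {1 2}/cone !lez_nat /=.
apply: (iffP and3P) => [[le _ /IH h] [|k] lek|h].
- by rewrite addn0.
- by rewrite addnS -addSn h.
- split; [by have := h 0 isT; rewrite addn0|by have := h 0 isT; rewrite /= addn0; lia|].
  by apply/IH => k lek; rewrite add1n addSnnS; exact: (h k.+1 lek).
Qed.

(** After a run from [a] to [e] that itself follows an up step, the next up step
    comes after D exactly when [a < e], and otherwise fixes the floor [e]. *)
Lemma supported_climb a t es :
  supported (Posz a) t (climb a es) =
  ((t != D) ==> all (leq a) es) && floors a es.
Proof.
elim: es a t => [|e es IH] a t; first by rewrite implybT.
rewrite /= andbT addr0 supported_run stays_run; last by move=> x y z; lia.
rewrite stays_above Order.POrderTheory.lexx /=.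
rewrite [X in supported X](_ : _ = Posz e); last by lia.
by rewrite IH; case: (ltngtP e a).
Qed.

Lemma floorsP a es :
  reflect (forall k j, k < j < size es -> nth 0 es k <= nth 0 (a :: es) k ->
             nth 0 es k <= nth 0 es j)
          (floors a es).
Proof.
elim: es a => [|e es IH] a /=; first by constructor => k j; lia.
apply: (iffP andP) => [[h1 /IH h2] [|k] [|j] //|h].
- by move=> lt /= le; move: h1; rewrite le => /(all_nthP 0); apply.
- exact: h2.
- split.
    by apply/implyP => le; apply/(all_nthP 0) => j lt; apply: (h 0 j.+1).
  by apply/IH => k j; apply: (h k.+1 j.+1).
Qed.

(** The last letter [n] is at least every other letter and no up step leaves
    from it, so the floor conditions only concern [c]. *)
Lemma steady_path_ofP n c : size c = n ->
  reflect ((forall k, k < n -> nth 0 c k <= k) /\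
           (forall k j, k.+1 < j < n -> nth 0 c k.+1 <= nth 0 c k ->
              nth 0 c k.+1 <= nth 0 c j))
          (steady n (path_of (rcons c n))).
Proof.
move=> szc; rewrite steadyE.
have -> : sorted (fun s t => ~~ turns s t) (path_of (rcons c n)).
  apply: (@path_sorted _ _ U); apply: turnless_run => // s.
  exact: turnless_climb.
set e := head 0 (rcons c n); set es := behead (rcons c n).
have E : rcons c n = e :: es by rewrite /e /es; case: (c).
have szes : size es = n by have := size_rcons c n; rewrite E szc => -[].
have laste : last e es = n by rewrite -[LHS]/(last 0 (e :: es)) -E last_rcons.
have nthE k :
  nth 0 (e :: es) k = if k < n then nth 0 c k else if k == n then n else 0.
  by rewrite -E nth_rcons szc.
rewrite /path_of -/e -/es offset_cat offset_run offset_climb laste.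
rewrite ups_cat ups_run ups_climb szes.
rewrite (_ : _ == _) ?eqxx /=; last by lia.
rewrite stays_run; last by rewrite /cone => x y z; lia.
rewrite supported_run [X in supported X](_ : _ = Posz e); last by lia.
rewrite ltn0 /= if_same supported_climb /=.
apply: (iffP andP) => [[/stays_cone h1 /floorsP h2]|[h1 h2]]; split.
- by move=> k lt; have := h1 k; rewrite szes nthE lt => /(_ (ltnW lt)).
- move=> k j lt le; have := h2 k j.-1; rewrite szes.
  by rewrite -![nth 0 es _]/(nth 0 (e :: es) _.+1) !nthE !(ifT, prednK) //; lia.
- apply/stays_cone => k; rewrite szes nthE => le.
  by case: ifP => [/h1//|]; case: eqP => // ->.
- apply/floorsP => k j; rewrite szes => /andP[lt ltj].
  rewrite -![nth 0 es _]/(nth 0 (e :: es) _.+1) !nthE.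
  have -> : k < n by lia.
  have -> : k.+1 < n by lia.
  case: ifP => [lt' le|jn le]; first by apply: h2 => //; lia.
  have -> : j.+1 == n by lia.
  by have := h1 k.+1; lia.
Qed.

Lemma steady_path_surj n P : steady n P ->
  exists2 c, size c = n & P = path_of (rcons c n).
Proof.
rewrite steadyE => /and5P[st off up srt _].
have EP := offsetsK st srt.
case E: (offsets 0 P) (offsets_gt0 0 P) EP => [//|e es] _ /= EP.
exists (belast e es).
  rewrite size_belast; move: up.
  by rewrite EP ups_cat ups_run ups_climb => /eqP.
suff <- : last e es = n by rewrite -lastI.
by move: off; rewrite EP offset_cat offset_run offset_climb; lia.
Qed.

(** * Lehmer codes and the pattern 1-34-2 *)

Section Lehmer.
Variable n : nat.
Implicit Types (p q : 'S_n) (i j : 'I_n).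

Definition smaller_after p i : {set 'I_n} :=
  [set l : 'I_n | (i < l) && (p l < p i)].
Definition lehmer p i : nat := #|smaller_after p i|.

Lemma card_ord_lt m k : k <= m -> #|[pred v : 'I_m | v < k]| = k.
Proof.
move=> le; rewrite -[RHS](card_ord k) -(@card_imset _ _ (widen_ord le)); last first.
  by move=> x y /(congr1 val)/= /val_inj.
apply: eq_card => v; rewrite !inE; apply/idP/imsetP => [lt|[w _ ->] /=].
  by exists (Ordinal (lt : v < k)) => //; apply: val_inj.
exact: ltn_ord.
Qed.

Lemma lehmer_lt p i : lehmer p i < n - i.
Proof.
have : #|smaller_after p i| <= #|[set l : 'I_n | i < l]|.
  by apply/subset_leq_card/subsetP => l; rewrite !inE => /andP[].
move=> /leq_ltn_trans; apply.
suff card_le : #|~: [set l : 'I_n | i < l]| = i.+1.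
  by have := cardsC [set l : 'I_n | i < l]; rewrite card_le card_ord; lia.
rewrite -[RHS](card_ord_lt (ltn_ord i)).
by apply: eq_card => l; rewrite !inE -leqNgt.
Qed.

(** By induction on the position: once p and q agree before i, the values still
    to be placed are the same, and c_i is the rank of p_i among them. *)
Lemma lehmer_inj p q : lehmer p =1 lehmer q -> p = q.
Proof.
move=> eqL.
(* By symmetry it is enough that q_i <= p_i when the prefixes agree. *)
wlog suff W : p q eqL /
    forall i : 'I_n, (forall l : 'I_n, l < i -> p l = q l) -> q i <= p i.
  suff H m (i : 'I_n) : i < m -> p i = q i by apply/permP => i; apply: (H n).
  elim: m i => // m IH i; rewrite ltnS => le; apply/val_inj/eqP.
  have eqlt (l : 'I_n) : l < i -> p l = q l by move=> lt; apply: IH; lia.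
  rewrite eqn_leq !W // => l lt; exact/esym/eqlt.
move=> i eqlt; rewrite leqNgt; apply/negP => lt.
have cardE r : lehmer r i = #|r @: smaller_after r i|.
  by rewrite card_imset //; apply: perm_inj.
have memE (r : 'S_n) v :
    (v \in r @: smaller_after r i) = (i < (r^-1)%g v) && (v < r i).
  apply/imsetP/idP => [[l]|h]; first by rewrite inE => ? ->; rewrite permK.
  by exists ((r^-1)%g v); rewrite ?inE permKV.
have inv_lt v : (forall l : 'I_n, l < i -> q l != v) -> i <= (q^-1)%g v.
  by move=> h; rewrite leqNgt; apply/negP => /h; rewrite permKV eqxx.
have := eqL i; rewrite !cardE; apply/eqP; rewrite ltn_eqF //.
apply: proper_card; apply/properP; split.
  apply/subsetP => v; rewrite !memE => /andP[iv vp].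
  rewrite (ltn_trans vp lt) andbT ltn_neqAle inv_lt ?andbT.
    by apply/eqP => /val_inj E; move: vp; rewrite -(permKV q v) -E; lia.
  move=> l li; rewrite -eqlt //; apply: contraTneq iv => <-.
  by rewrite permK -leqNgt ltnW.
(* p_i itself is a value below q_i that q places after i, but not p. *)
exists (p i); rewrite memE ?ltnn ?andbF // lt andbT ltn_neqAle inv_lt ?andbT.
  by apply/eqP => /val_inj E; move: lt; rewrite -(permKV q (p i)) -E ltnn.
by move=> l li; rewrite -eqlt // (inj_eq perm_inj) neq_ltn li.
Qed.

(** Both sides have n! elements, so injectivity suffices. *)
Lemma lehmer_surj (c : 'I_n -> nat) :
  (forall i, c i < n - i) -> exists p, lehmer p =1 c.
Proof.
move=> cP.
pose F (i : 'I_n) : pred 'I_n.+1 := fun v => v < n - i.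
pose L p : {ffun 'I_n -> 'I_n.+1} := [ffun i => inord (lehmer p i)].
have LE p i : L p i = lehmer p i :> nat.
  by rewrite ffunE inordK //; have := lehmer_lt p i; lia.
have L_inj : injective L.
  by move=> p q E; apply: lehmer_inj => i; rewrite -!LE E.
have subL : L @: [set: 'S_n] \subset family F.
  apply/subsetP => _ /imsetP[p _ ->]; apply/familyP => i.
  by rewrite unfold_in LE lehmer_lt.
have cardL : #|L @: [set: 'S_n]| = #|family F|.
  rewrite card_imset // cardsT card_Sn card_family foldrE big_map big_enum /=.
  rewrite fact_prod big_add1 big_mkord (reindex_inj rev_ord_inj) /=.
  apply: eq_bigr => i _.
  by rewrite subnSK // card_ord_lt //; lia.
have := subset_cardP cardL subL.
pose f : {ffun 'I_n -> 'I_n.+1} := [ffun i => inord (c i)].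
have fE i : f i = c i :> nat by rewrite ffunE inordK //; have := cP i; lia.
have : f \in family F by apply/familyP => i; rewrite unfold_in fE.
move=> fF /(_ f); rewrite fF => /imsetP[p _ E].
by exists p => i; rewrite -LE -E fE.
Qed.

(** At an ascent every entry counted at i is counted at i+1; at a descent the
    inclusion is reversed, and strict since p_{i+1} is counted only at i. *)
Lemma ascent_lehmer p i i' : i' = i.+1 :> nat ->
  (p i < p i') = (lehmer p i <= lehmer p i').
Proof.
move=> i'E; apply/idP/idP => [lt|].
  apply/subset_leq_card/subsetP => l; rewrite !inE => /andP[il li].
  rewrite (ltn_trans li lt) andbT i'E ltn_neqAle il andbT -i'E.
  by apply: contraTneq li => /val_inj <-; lia.
rewrite !ltnNge; apply: contraTN => le; rewrite -ltnNge.
apply: proper_card; apply/properP; split.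
  by apply/subsetP => l; rewrite !inE; lia.
exists i'; rewrite !inE ?ltnn // i'E ltnSn /= ltn_neqAle le andbT.
by apply/eqP => /val_inj/perm_inj E; move: i'E; rewrite E; lia.
Qed.

(** Let j be an ascent and i < j.  Unless some p_l plays the 2 of a pattern
    using i, j and j+1, all entries counted at j are also smaller than p_i,
    hence counted at i.  Conversely, in an occurrence of the pattern choose i
    last among the positions that can play the 1: no entry between i and j is
    smaller than p_i, so the entries counted at i are counted at j, where p_l
    is counted in addition. *)
Lemma avoids_lehmerP p :
  reflect (forall i j j', i < j -> j' = j.+1 :> nat ->
             lehmer p j <= lehmer p j' -> lehmer p j <= lehmer p i)
          (avoids_1_34_2 p).
Proof.
apply: (iffP idP) => [av i j j' ij j'E|h].
  rewrite -(ascent_lehmer _ j'E) => asc.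
  apply/subset_leq_card/subsetP => l; rewrite !inE => /andP[jl lj].
  rewrite (ltn_trans ij jl) ltnNge; apply: contraNN av => il.
  apply/existsP; exists i; apply/existsP; exists j.
  apply/existsP; exists j'; apply/existsP; exists l.
  rewrite ij j'E eqxx asc lj !andbT /=; apply/andP; split.
    rewrite ltn_neqAle jl andbT -j'E.
    by apply: contraTneq lj => /val_inj <-; lia.
  rewrite ltn_neqAle il andbT; apply/eqP => /val_inj/perm_inj E.
  by move: jl; rewrite -E; lia.
apply/negP => /existsP[i0 /existsP[j /existsP[j' /existsP[l]]]].
case/and5P => ij /eqP j'E jl il /andP[lj asc].
pose Q : pred 'I_n := fun i => (i < j) && (p i < p l).
have Qi0 : Q i0 by rewrite /Q ij.
case: (@arg_maxnP _ i0 Q (fun i : 'I_n => val i) Qi0) => i /andP[ij' il'] imax.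
have := h i j j' ij' j'E; rewrite -(ascent_lehmer _ j'E) => /(_ asc).
apply/negP; rewrite -ltnNge; apply: proper_card; apply/properP; split.
  apply/subsetP => k; rewrite !inE => /andP[ik ki].
  rewrite (ltn_trans ki (ltn_trans il' lj)) andbT ltnNge; apply/negP => kj.
  case: (ltngtP k j) kj => // [kj|/val_inj kj] _; last first.
    by move: ki; rewrite kj; lia.
  by have := imax k; rewrite /Q kj (ltn_trans ki il') /= => /(_ isT); lia.
exists l; rewrite !inE; lia.
Qed.

(** The Lehmer code is read from right to left, so that its k-th letter is at
    most k, like the offset at an up step at height b = k. *)
Definition code p : seq nat := [seq lehmer p (rev_ord k) | k <- enum 'I_n].

Lemma size_code p : size (code p) = n.
Proof. by rewrite size_map size_enum_ord. Qed.

Lemma nth_code p i : nth 0 (code p) i = lehmer p (rev_ord i).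
Proof. by rewrite (nth_map i) ?size_enum_ord // nth_ord_enum. Qed.

Lemma steady_code p : steady n (path_of (rcons (code p) n)) = avoids_1_34_2 p.
Proof.
apply/(steady_path_ofP (size_code p))/avoids_lehmerP => [[_ h] i j j' ij j'E|h].
  have jn := ltn_ord j'.
  have := h (rev_ord j') (rev_ord i).
  have -> : (rev_ord j').+1 = rev_ord j by rewrite /=; lia.
  rewrite !nth_code !rev_ordK => h' le; apply: h' => //.
  by rewrite /=; lia.
split.
  move=> k lt; rewrite -[k]/(val (Ordinal lt)) nth_code.
  by have := lehmer_lt p (rev_ord (Ordinal lt)); rewrite /=; lia.
move=> k j /andP[kj jn].
have kn : k.+1 < n by lia.
have kn' : k < n by lia.
rewrite -[k.+1]/(val (Ordinal kn)) -[k]/(val (Ordinal kn')).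
rewrite -[j]/(val (Ordinal jn)).
by rewrite !nth_code; apply: h => /=; lia.
Qed.

Lemma code_inj : injective code.
Proof.
move=> p q E; apply: lehmer_inj => i.
by rewrite -(rev_ordK i) -!nth_code E.
Qed.

Lemma code_surj c : size c = n -> (forall k, k < n -> nth 0 c k <= k) ->
  exists p, code p = c.
Proof.
move=> szc cP.
have [i|p pE] := @lehmer_surj (fun i => nth 0 c (rev_ord i)).
  by have := cP (rev_ord i) (ltn_ord _); have := ltn_ord i; rewrite /=; lia.
exists p; apply: (@eq_from_nth _ 0); rewrite size_code // => k lt.
by rewrite -[k]/(val (Ordinal lt)) nth_code pE rev_ordK.
Qed.
End Lehmer.

(** * The bijection *)

Definition perm_path n (p : AV_1_34_2 n) : steady_path n :=
  exist _ (path_of (rcons (code (val p)) n))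
    (etrans (steady_code (val p)) (valP p)).

Lemma perm_path_inj n : injective (@perm_path n).
Proof.
move=> p q /(congr1 val)/(congr1 (offsets 0)); rewrite !path_ofK ?size_rcons //.
by move=> E; apply/val_inj/code_inj; apply: rcons_injl E.
Qed.

Lemma perm_path_surj n (P : steady_path n) : exists p, perm_path p == P.
Proof.
case: P => P stP; have [c szc PE] := steady_path_surj stP; subst P.
have [cP _] := elimT (steady_path_ofP szc) stP.
have [p pE] := code_surj szc cP; subst c.
have av : avoids_1_34_2 p by rewrite -steady_code.
by exists (exist _ p av); apply/eqP/val_inj.
Qed.

Theorem theorem30 (n : nat) (hn : (1 <= n)%N) :
  {f : steady_path n -> AV_1_34_2 n | bijective f}.
Proof.
exists (fun P => xchoose (perm_path_surj P)).
have K : cancel (fun P => xchoose (perm_path_surj P)) (@perm_path n).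
  by move=> P; apply/eqP/(xchooseP (perm_path_surj P)).
exists (@perm_path n) => // p.
by apply: perm_path_inj; rewrite K.
Qed.
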